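(* For any integer $n\ge 2$ and any $1\le k\le n$, $|AW_{n,k}|=|BW_{n,n+1-k}|$.
   Context: For a permutation $\pi=p_1p_2\ldots p_n$ of $[n]$ (one-line notation), an index $i$ is a weak excedance if $p_i\ge i$; $W_{n,m}$ is the set of permutations of $[n]$ with exactly $m$ weak excedances. $AW_{n,m}=\{\pi=p_1\ldots p_n\in W_{n,m} : p_1<p_n\}$ and $BW_{n,m}=W_{n,m}\setminus AW_{n,m}$ (those with $p_1>p_n$). *)

(* Defs.v *)
From mathcomp Require Import all_boot all_fingroup.

Set Implicit Arguments.
Unset Strict Implicit.
Unset Printing Implicit Defensive.

(* A permutation of [n] is an element of 'S_n, acting on 'I_n = {0, ..., n-1}. *)

(* The word p_1 p_2 ... p_n, with letters in {1, ..., n}. *)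
Definition one_line (n : nat) (s : 'S_n) : seq nat :=
  [seq (val (s i)).+1 | i <- enum 'I_n].

Definition first_letter (n : nat) (s : 'S_n) : nat := head 0 (one_line s).

Definition last_letter (n : nat) (s : 'S_n) : nat := last 0 (one_line s).

(* The condition p_i >= i is unaffected by shifting both sides to start at 0. *)
Definition weak_excedances (n : nat) (s : 'S_n) : {set 'I_n} :=
  [set i : 'I_n | i <= s i].

Definition W (n m : nat) : {set 'S_n} := [set s : 'S_n | #|weak_excedances s| == m].

Definition AW (n m : nat) : {set 'S_n} :=
  [set s in W n m | first_letter s < last_letter s].

Definition BW (n m : nat) : {set 'S_n} := W n m :\: AW n m.

(* Main.v *)
Require Import Defs.
From mathcomp Require Import all_boot all_fingroup.
From mathcomp Require Import zify.

Set Implicit Arguments.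
Unset Strict Implicit.
Unset Printing Implicit Defensive.

(* Reverse the word p and map each letter j to n - j, fixing the letter n.  This
   involution sends m weak excedances to n + 1 - m: the position n + 1 - i is a
   weak excedance of the image iff p_i = n or i is not a weak excedance of p.  It
   exchanges p_1 < p_n and p_1 > p_n when one of p_1, p_n equals n.  Otherwise it
   preserves their order, but then swapping the first and last letters of the
   image corrects this without moving any weak excedance, because the first
   position is always one and the last one is one only for the letter n. *)

Local Open Scope group_scope.

Lemma first_letterE n (s : 'S_n.+1) : first_letter s = (s ord0).+1.
Proof. by rewrite /first_letter /one_line enum_ordSl. Qed.

Lemma last_letterE n (s : 'S_n.+1) : last_letter s = (s ord_max).+1.
Proof. by rewrite /last_letter /one_line enum_ordSr map_rcons last_rcons. Qed.

Definition rev_perm n : 'S_n := perm (@rev_ord_inj n).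

(** Reversal after the cyclic successor: injectivity comes for free, and the largest index wraps
    around to 0, which reversal sends back to the top. *)
Definition rev_fix_max n : 'S_n :=
  perm (inj_comp (@rev_ord_inj n) (@ordS_inj n)).

Lemma val_rev_perm n (i : 'I_n.+1) : rev_perm n.+1 i = n - i :> nat.
Proof. by rewrite permE /= subSS. Qed.

Lemma val_rev_fix_max n (i : 'I_n.+1) :
  rev_fix_max n.+1 i = (if i == ord_max then n else n.-1 - i) :> nat.
Proof.
rewrite permE /= subSS -val_eqE /=.
case: eqP => [->|/eqP ni]; first by rewrite modnn subn0.
by rewrite modn_small; have := ltn_ord i; lia.
Qed.

Lemma rev_fix_max_eq n (i : 'I_n.+1) :
  (rev_fix_max n.+1 i == ord_max) = (i == ord_max).
Proof.
rewrite -val_eqE /= val_rev_fix_max; case: (eqVneq i) => [_|]; first by rewrite eqxx.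
by rewrite -val_eqE /=; have := ltn_ord i; lia.
Qed.

Lemma rev_permV n : rev_perm n * rev_perm n = 1.
Proof. by apply/permP => i; rewrite permM !permE rev_ordK. Qed.

Lemma rev_fix_maxV n : rev_fix_max n.+1 * rev_fix_max n.+1 = 1.
Proof.
apply/permP => i; apply/val_inj; rewrite permM perm1 /= val_rev_fix_max.
rewrite rev_fix_max_eq val_rev_fix_max; case: (eqVneq i) => [->//|].
by rewrite -val_eqE /=; have := ltn_ord i; lia.
Qed.

Lemma rev_perm0 n : rev_perm n.+1 ord0 = ord_max.
Proof. by apply/val_inj; rewrite /= val_rev_perm subn0. Qed.

Lemma rev_perm_max n : rev_perm n.+1 ord_max = ord0.
Proof. by apply/val_inj; rewrite /= val_rev_perm subnn. Qed.

Definition swap_ends n : 'S_n.+1 := tperm ord0 ord_max.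

(** Reversal exchanges the two ends, so conjugation by it fixes their transposition. *)
Lemma swap_ends_rev n :
  swap_ends n * rev_perm n.+1 = rev_perm n.+1 * swap_ends n.
Proof.
have := tpermJ ord0 ord_max (rev_perm n.+1).
by rewrite rev_perm0 rev_perm_max [tperm ord_max _]tpermC conjgC => ->.
Qed.

Definition max_at_end n (s : 'S_n.+1) : bool :=
  (s ord0 == ord_max) || (s ord_max == ord_max).

Definition rev_flip n (s : 'S_n.+1) : 'S_n.+1 :=
  rev_perm n.+1 * s * rev_fix_max n.+1.

Definition flip n (s : 'S_n.+1) : 'S_n.+1 :=
  if max_at_end s then rev_flip s else swap_ends n * rev_flip s.

Lemma max_at_end_rev_flip n (s : 'S_n.+1) :
  max_at_end (rev_flip s) = max_at_end s.
Proof.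
by rewrite /max_at_end !permM rev_perm0 rev_perm_max !rev_fix_max_eq orbC.
Qed.

Lemma max_at_end_swap n (s : 'S_n.+1) :
  max_at_end (swap_ends n * s) = max_at_end s.
Proof. by rewrite /max_at_end !permM tpermL tpermR orbC. Qed.

Lemma rev_flipK n : involutive (@rev_flip n).
Proof.
move=> s; rewrite /rev_flip !mulgA rev_permV mul1g.
by rewrite -mulgA rev_fix_maxV mulg1.
Qed.

Lemma rev_flip_swap n (s : 'S_n.+1) :
  rev_flip (swap_ends n * s) = swap_ends n * rev_flip s.
Proof. by rewrite /rev_flip !mulgA swap_ends_rev. Qed.

(** Both [rev_flip] and the swap preserve [max_at_end], so the second application takes the same
    branch; the two are commuting involutions. *)
Lemma flipK n : involutive (@flip n).
Proof.
move=> s; rewrite {2}/flip; case: ifP => end_s.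
  by rewrite /flip max_at_end_rev_flip end_s rev_flipK.
rewrite /flip max_at_end_swap max_at_end_rev_flip end_s.
by rewrite rev_flip_swap rev_flipK mulgA tperm2 mul1g.
Qed.

Lemma flip_ends n (s : 'S_n.+2) :
  (flip s ord0 < flip s ord_max) = ~~ (s ord0 < s ord_max).
Proof.
(* The size [n.+2] makes the two end positions distinct. *)
have ne : s ord0 != s ord_max by rewrite (inj_eq perm_inj).
rewrite /flip /max_at_end; case: ifPn => end_s; last first.
  move: end_s; rewrite negb_or => /andP[ns0 nsm].
  rewrite !permM tpermL tpermR rev_perm0 rev_perm_max.
  rewrite !val_rev_fix_max (negPf ns0) (negPf nsm).
  move: ne ns0 nsm; rewrite -!val_eqE /=.
  by have := ltn_ord (s ord0); have := ltn_ord (s ord_max); lia.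
rewrite !permM rev_perm0 rev_perm_max !val_rev_fix_max.
move: ne end_s; rewrite -!val_eqE /=.
have := ltn_ord (s ord0); have := ltn_ord (s ord_max).
by case: (eqVneq _ n.+1) => ?; case: (eqVneq _ n.+1); lia.
Qed.

Lemma weak_excedances_rev_flip n (s : 'S_n.+1) :
  #|weak_excedances (rev_flip s)| + #|weak_excedances s| = n.+2.
Proof.
rewrite -!sum1dep_card [X in X + _](reindex_perm (rev_perm n.+1)) /=.
rewrite [X in X + _]big_mkcond [X in _ + X]big_mkcond -big_split /=.
(* Position [i] of [s] and its mirror position in the image together contribute 1, or 2 when [s i]
   is the largest letter, which happens exactly once. *)
transitivity (\sum_(i < n.+1) (1 + (s i == ord_max))); last first.
  rewrite big_split /= sum1_card card_ord (bigD1 (s^-1 ord_max)) //=.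
  rewrite permKV eqxx big1 ?addn1 // => i ni.
  by rewrite -(inj_eq (@perm_inj _ s^-1)) permK (negPf ni).
apply: eq_bigr => i _.
rewrite !permM val_rev_perm -[rev_perm _ (rev_perm _ i)]permM rev_permV perm1.
rewrite val_rev_fix_max -!val_eqE /=.
move: (ltn_ord i) (ltn_ord (s i)) => ? ?.
by case: eqP => ?; case: leqP => ?; case: leqP => ?; lia.
Qed.

Lemma weak_excedances_swap n (s : 'S_n.+1) : ~~ max_at_end s ->
  weak_excedances (swap_ends n * s) = weak_excedances s.
Proof.
rewrite negb_or => /andP[ns0 nsm]; apply/setP => i; rewrite !inE permM.
case: tpermP => [->//|->|//]; move: ns0 nsm; rewrite -!val_eqE /=.
by have := ltn_ord (s ord0); have := ltn_ord (s ord_max); lia.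
Qed.

Lemma weak_excedances_flip n (s : 'S_n.+1) :
  #|weak_excedances (flip s)| + #|weak_excedances s| = n.+2.
Proof.
rewrite /flip; case: ifPn => end_s; first exact: weak_excedances_rev_flip.
by rewrite weak_excedances_swap ?max_at_end_rev_flip // weak_excedances_rev_flip.
Qed.

Theorem theorem3p3 (n k : nat) (hn : 2 <= n) (hk : 1 <= k <= n) :
  #|AW n k| = #|BW n (n + 1 - k)|.
Proof.
case: n hn hk => [//|[//|n]] _ hk.
rewrite -(card_imset (mem (AW _ k)) (can_inj (@flipK n.+1))).
(* Since [flip] is its own inverse, the image is a preimage, and membership can be compared for each
   [s] separately. *)
rewrite (can2_imset_pre _ (@flipK n.+1) (@flipK n.+1)).
apply: eq_card => s; rewrite !inE !first_letterE !last_letterE !ltnS flip_ends.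
(* The bound on [k] in [hk] keeps the subtraction from truncating. *)
by have := weak_excedances_flip s; lia.
Qed.
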